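(* Consider the online resource allocation problem with type-only samples described in the context. No online policy can beat an $\Omega(T)$ regret lower bound, even under assumptions (A1) and (A2) below. That is, there is a constant $c>0$ such that for all sufficiently large $T$ and every online policy using type-only samples, there is a problem instance class (capacities, consumption vectors, distributions $P_1,\dots,P_T$ and $F_1,\dots,F_n$), with $m$, $n$ and the constants in (A1) not depending on $T$, which satisfies (A1) and (A2) and on which the regret of the policy is at least $cT$. (A1) For each $j\in[n]$, $F_j$ has a density $f_j$ supported on $[\underline r_j,\bar r_j]$ with $0<\underline r_j<\bar r_j<\infty$, and there are constants $0<\alpha<\beta<\infty$ with $\alpha\le f_j(r)\le\beta$ for all $j\in[n]$ and $r\in[\underline r_j,\bar r_j]$. (A2) $\Pr[\hat d_j\ge 1]=1$ for every $j\in[n]$, where $\hat d_j=\sum_{t=1}^T\mathbb 1\{\hat j_t=j\}$.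
   Context: Problem. There are $m$ resources with initial capacities $C_i\ge 0$ and $n$ query types; type $j$ has a fixed consumption vector $\boldsymbol a_j=(a_{j,1},\dots,a_{j,m})\in\mathbb R_{\ge0}^m$ and a reward distribution with cdf $F_j$. In each period $t\in[T]$ one query arrives; its type $j_t\in[n]$ is drawn from a distribution $P_t$ on $[n]$, independently across periods (the $P_t$ are arbitrary and may vary with $t$). Given $j_t=j$, its reward $r_t$ is drawn independently from $F_j$, and it needs $\boldsymbol a_{j}$ units of the resources. After $(r_t,j_t)$ is observed, the decision maker immediately and irrevocably chooses $x_t\in\{0,1\}$ (serve or not); serving requires every remaining capacity $i$ to be at least $a_{j_t,i}$. The $P_t$ and $F_j$ are unknown to the decision maker. Type-only samples. Before the process starts the decision maker has, for each $t\in[T]$, one sample type $\hat j_t\sim P_t$; the samples are independent of each other and of the instance. No historical rewards are available. Online policy. The decision $x_t$ may depend only on the known problem data ($T$, capacities, consumption vectors), the historical samples $\hat j_1,\dots,\hat j_T$, and the observed types and rewards of periods $1,\dots,t$; the decisions must always satisfy $\sum_{t}a_{j_t,i}x_t\le C_i$ for all $i$. Regret. For an instance $I=\{(r_t,\boldsymbol a_{j_t})\}_{t=1}^T$ let $V^{\rm off}(I)=\max\{\sum_t r_tx_t:\ \sum_t a_{j_t,i}x_t\le C_i\ \forall i,\ x_t\in\{0,1\}\}$. The regret of an online policy is $\mathbb E[V^{\rm off}(I)]-\mathbb E[\sum_t r_tx_t]$, where $x_t$ are the policy's decisions and the expectation is over the instance and the historical samples used by the policy. *)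

(* Defs.v *)
From HB Require Import structures.
From mathcomp Require Import all_boot all_order all_algebra.
From mathcomp Require Import all_classical all_reals all_analysis.

Set Implicit Arguments.
Unset Strict Implicit.
Unset Printing Implicit Defensive.
Import Order.TTheory GRing.Theory Num.Theory.
Local Open Scope classical_set_scope.
Local Open Scope ring_scope.

HB.instance Definition _ (n : nat) := isPointed.Build 'I_n.+1 ord0.
HB.instance Definition _ (n : nat) :=
  @isMeasurable.Build default_measure_display 'I_n.+1
    discrete_measurable discrete_measurable0
    discrete_measurableC discrete_measurableU.

(* Mutual independence of a finite family of systems of events (in use: the
   sigma-algebras generated by random variables with different codomains). *)
Definition mutually_independent d (Omega : measurableType d) (R : realType)
    (Pr : probability Omega R) (I : finType) (G : I -> set (set Omega)) : Prop :=
  forall (J : {set I}) (A : I -> set Omega),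
    (forall i, i \in J -> G i (A i)) ->
    Pr (\bigcap_(i in [set` J]) A i) = (\prod_(i in J) Pr (A i))%E.

Section Allocation.
Variables (R : realType) (m n T : nat).

(* There are n.+1 query types: a distribution on types exists only if there is
   at least one. *)
Local Notation qtype := 'I_n.+1.

Record problem := Problem {
  capacity : 'I_m -> R;
  consumption : qtype -> 'I_m -> R;
  type_law : 'I_T -> probability qtype R;
  reward_law : qtype -> probability R R;
  capacity_ge0 : forall i, 0 <= capacity i;
  consumption_ge0 : forall j i, 0 <= consumption j i }.

Definition feasible (C : 'I_m -> R) (a : qtype -> 'I_m -> R)
    (j : 'I_T -> qtype) (x : 'I_T -> bool) : bool :=
  [forall i, \sum_(t < T) a (j t) i * (x t)%:R <= C i].

(* The default value 0 of the maximum is the value of x = 0, which is feasible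
   when the capacities are nonnegative. *)
Definition Voff (C : 'I_m -> R) (a : qtype -> 'I_m -> R)
    (q : 'I_T -> qtype * R) : R :=
  \big[Num.max/0]_(x : {ffun 'I_T -> bool} | feasible C a (fst \o q) x)
    \sum_(t < T) (q t).2 * (x t)%:R.

Definition history (q : 'I_T -> qtype * R) (t : 'I_T) :
    t.+1.-tuple (qtype * R) :=
  [tuple q (widen_ord (ltn_ord t) s) | s < t.+1].

(* A policy for horizon T maps the capacities, the consumption vectors, the T
   historical sample types and the (type, reward) pairs of periods up to t to
   the decision in period t; it has no access to the laws. *)
Record policy := Policy {
  decide : ('I_m -> R) -> (qtype -> 'I_m -> R) -> ('I_T -> qtype) ->
    forall t : 'I_T, t.+1.-tuple (qtype * R) -> bool;
  decide_measurable : forall C a jhat t,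
    measurable_fun setT (@decide C a jhat t);
  decide_feasible : forall C a jhat q,
    (forall i, 0 <= C i) -> (forall j i, 0 <= a j i) ->
    feasible C a (fst \o q) (fun t => @decide C a jhat t (history q t)) }.

Definition policy_value (pi : policy) (C : 'I_m -> R) (a : qtype -> 'I_m -> R)
    (jhat : 'I_T -> qtype) (q : 'I_T -> qtype * R) : R :=
  \sum_(t < T) (q t).2 * (decide pi C a jhat (history q t))%:R.

(* A random instance together with the historical samples, on a probability
   space Pr: the samples and the (type, reward) pairs of all periods are
   mutually independent, with the laws prescribed by the problem. *)
Record realization (I : problem) d (Omega : measurableType d)
    (Pr : probability Omega R) := Realization {
  sample : 'I_T -> {RV Pr >-> qtype};
  query : 'I_T -> {RV Pr >-> (qtype * R)%type};
  sample_law : forall t (A : set qtype),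
    Pr (sample t @^-1` A) = type_law I t A;
  query_law : forall t (j : qtype) (B : set R),
    measurable B ->
    Pr (query t @^-1` ([set j] `*` B)) =
      (type_law I t [set j] * reward_law I j B)%E;
  realization_independent :
    mutually_independent Pr (fun u : ('I_T + 'I_T)%type =>
      match u with
      | inl t => g_sigma_algebra_preimage (sample t)
      | inr t => g_sigma_algebra_preimage (query t)
      end) }.

Definition regret (pi : policy) (I : problem) d (Omega : measurableType d)
    (Pr : probability Omega R) (X : realization I Pr) : \bar R :=
  ('E_Pr[fun w => Voff (capacity I) (consumption I) (fun t => query X t w)] -
   'E_Pr[fun w => policy_value pi (capacity I) (consumption I)
                    (fun t => sample X t w) (fun t => query X t w)])%E.

Definition A1 (rlo rhi : qtype -> R) (alpha beta : R) (I : problem) : Prop :=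
  [/\ forall j, 0 < rlo j < rhi j,
      0 < alpha < beta &
      forall j, exists f : R -> R,
        [/\ measurable_fun setT f,
            forall B, measurable B ->
              reward_law I j B = (\int[lebesgue_measure]_(x in B) (f x)%:E)%E,
            forall x, ~~ (rlo j <= x <= rhi j) -> f x = 0 &
            forall x, rlo j <= x <= rhi j -> alpha <= f x <= beta]].

Definition A2 (I : problem) d (Omega : measurableType d)
    (Pr : probability Omega R) (X : realization I Pr) : Prop :=
  forall j : qtype,
    Pr [set w | (1 <= \sum_(t < T) (sample X t w == j))%N] = 1%E.

End Allocation.

(* Main.v *)
Require Import Defs.
From HB Require Import structures.
From mathcomp Require Import all_boot all_order all_algebra.
From mathcomp Require Import all_classical all_reals all_analysis.
From mathcomp Require Import measurable_realfun ring lra.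
Import Order.TTheory GRing.Theory Num.Theory.
Local Open Scope ring_scope.
Local Open Scope classical_set_scope.
Set Implicit Arguments.
Unset Strict Implicit.
Unset Printing Implicit Defensive.

(* One resource of capacity h = T/2 and two types of unit consumption: type 0
   arrives in the first h periods, type 1 afterwards, so the sample types reveal
   nothing. Type-0 rewards are uniform on [7/4, 2]; type-1 rewards lie in
   [1/2, 3] and, up to mass 1/120, are at most 1 in the low world and at least
   11/4 in the high one. During the first h periods a policy cannot tell the
   worlds apart, so it accepts the same number K of type-0 queries in both:
   each acceptance costs about 1 in the high world, each rejection about 1 in
   the low world. On a coupling of both worlds the two regrets add up pathwise to
   at least h/2 - 5 (number of atypical type-1 rewards), whose expectation is at
   least T/12; hence one of the two regrets is at least T/24. *)

(** * Independent draws on a product space *)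

(** Induction on the number of draws: the new space is the product of the law of draw 0 with the
    space of the remaining draws. The space and its display thus change with [n], hence the
    existential form. [unlift ord0] tells draw 0 (first component) from the shifted ones (second
    component). *)
Lemma independent_family (R : realType) d (S : measurableType d) n
    (mu : 'I_n -> probability S R) :
  exists (d' : measure_display) (Omega : measurableType d')
         (P : probability Omega R) (W : 'I_n -> Omega -> S),
    (forall t, measurable_fun setT (W t)) /\
    forall B : 'I_n -> set S, (forall t, measurable (B t)) ->
      P [set w | forall t, B t (W t w)] = (\prod_(t < n) mu t (B t))%E.
Proof.
elim: n mu => [|n IH] mu.
  exists default_measure_display, unit, \d_tt, (fun _ _ => point).
  split=> [[]//|B _]; rewrite big_ord0 /= diracE mem_set// => t.
  by case: t.
have [d1 [Om [P [W [mW PW]]]]] := IH (fun t => mu (lift ord0 t)).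
exists (measure_prod_display (d, d1)), (S * Om)%type.
exists (mu ord0 \x P)%E.
exists (fun t w => oapp (fun s => W s w.2) w.1 (unlift ord0 t)).
split=> [t|B mB].
  case: (unlift ord0 t) => [s|] /=.
    exact: measurableT_comp.
  exact: measurable_fst.
rewrite big_ord_recl -(PW (fun t => B (lift ord0 t)))//.
rewrite -[RHS]product_measure1E//; last first.
  rewrite (_ : [set _ | _] =
      \bigcap_(t in [set: 'I_n]) (W t @^-1` B (lift ord0 t))).
    apply: fin_bigcap_measurable => // t _.
    by rewrite -[X in measurable X]setTI; exact: mW.
  by apply/seteqP; split=> w /= Bw t => [_|]; exact: Bw.
congr (_ _); apply/seteqP; split=> -[s w] /=.
  move=> Bw; split=> [|t]; first by have := Bw ord0; rewrite unlift_none.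
  by have := Bw (lift ord0 t); rewrite liftK.
by move=> [Bs Bw] t; case: unliftP => [j ->|->] //=; exact: Bw.
Qed.

(** * Mixtures and reward laws with bounded densities *)

Lemma mixture (R : realType) d (S : measurableType d) (p : R) (P Q : probability S R) :
  0 <= p <= 1 ->
  exists M : probability S R, forall A, M A = (p%:E * P A + (1 - p)%:E * Q A)%E.
Proof.
move=> /andP[p0 p1].
have q0 : 0 <= 1 - p by rewrite subr_ge0.
pose M : {measure set S -> \bar R} :=
  measure_add (mscale (NngNum p0) P) (mscale (NngNum q0) Q).
have ME A : M A = (p%:E * P A + (1 - p)%:E * Q A)%E by rewrite [LHS]measure_addE.
have M1 : M setT = 1%E by rewrite ME !probability_setT !mule1 -EFinD subrKC.
(* [M] has total mass 1, so normalising only repackages it as a probability. *)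
exists (mnormalize M P) => A; rewrite -ME.
by rewrite /= /mnormalize [M setT]M1 onee_eq0 /= invr1 mule1.
Qed.


(** The density clause of [A1], isolated for a single law so that each reward law can be treated
    separately. *)
Definition density_between (R : realType) (lo hi alpha beta : R) (F : probability R R) :=
  exists f : R -> R,
        [/\ measurable_fun setT f,
            forall B, measurable B ->
              F B = (\int[lebesgue_measure]_(x in B) (f x)%:E)%E,
            forall x, ~~ (lo <= x <= hi) -> f x = 0 &
            forall x, lo <= x <= hi -> alpha <= f x <= beta].

(** Mix the uniform law on [lo, hi] with weight p, which keeps the density above p / (hi - lo) on
    the whole range, and the uniform law on [a, b] with weight 1 - p, which supplies the mass there.
    Both weights are at most 1, so the sum of the two uniform densities bounds the density from
    above. *)
Lemma concentrated_law (R : realType) (p lo hi a b : R) :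
  0 <= p <= 1 -> lo <= a -> a < b -> b <= hi ->
  exists F : probability R R,
    density_between lo hi (p / (hi - lo)) ((hi - lo)^-1 + (b - a)^-1) F /\
    ((1 - p)%:E <= F `[a, b]%classic)%E.
Proof.
move=> p01 loa ab bhi; have lohi : lo < hi by lra.
have [M ME] := mixture (uniform_prob lohi) (uniform_prob ab) p01.
(* [uniform_prob] lives on [measurableTypeR R], whose display is not that of [R]. *)
have mid : @measurable_fun _ _ (measurableTypeR R) R setT idfun.
  by move=> _ A mA; rewrite setTI preimage_id.
pose F : probability R R :=
  @distribution _ _ _ R _ M (@mfun_Sub _ _ (measurableTypeR R) R idfun (mem_set mid)).
have FE A : F A = (p%:E * uniform_prob lohi A + (1 - p)%:E * uniform_prob ab A)%E.
  by rewrite -ME.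
have /andP[p0 p1] := p01.
exists F; split; last first.
  rewrite FE -[leLHS]add0e leeD//; first by rewrite mule_ge0// lee_fin.
  by rewrite [X in (_ * X)%E]integral_uniform_pdf1// mule1.
exists (fun x => p * uniform_pdf lo hi x + (1 - p) * uniform_pdf a b x); split.
- by apply: measurable_funD; apply: measurable_funM => //; exact: measurable_uniform_pdf.
- move=> B mB; rewrite FE /=.
  have mE q (c e : R) : measurable_fun B (fun x => (q * uniform_pdf c e x)%:E).
    apply/measurable_EFinP/measurable_funM => //.
    by apply: measurable_funTS; exact: measurable_uniform_pdf.
  have pdfZ q (c e : R) (ce : c < e) : 0 <= q ->
      (\int[lebesgue_measure]_(x in B) (q * uniform_pdf c e x)%:E =
       q%:E * uniform_prob ce B)%E.
    move=> q0; under eq_integral do rewrite EFinM.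
    rewrite ge0_integralZl_EFin//.
    - by move=> x _; rewrite lee_fin uniform_pdf_ge0.
    - by apply/measurable_EFinP; apply: measurable_funTS; exact: measurable_uniform_pdf.
  under [RHS]eq_integral do rewrite EFinD.
  rewrite ge0_integralD//=.
  + by rewrite !pdfZ// subr_ge0.
  + by move=> x _; rewrite lee_fin mulr_ge0// uniform_pdf_ge0.
  + exact: mE.
  + by move=> x _; rewrite lee_fin mulr_ge0 ?subr_ge0// uniform_pdf_ge0.
  + exact: mE.
- move=> x xlohi; rewrite /uniform_pdf (negbTE xlohi) ifF ?mulr0 ?addr0//.
  by apply: contraNF xlohi => /andP[ax xb]; apply/andP; split; lra.
- move=> x xlohi; rewrite /uniform_pdf xlohi.
  have u0 : 0 < (hi - lo)^-1 by rewrite invr_gt0 subr_gt0.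
  have v0 : 0 < (b - a)^-1 by rewrite invr_gt0 subr_gt0.
  by case: ifP => _; apply/andP; split; nra.
Qed.

(** The density vanishes outside [lo, hi], so [F] is carried by that interval, on which clamping is
    the identity. *)
Lemma law_clamp (R : realType) (lo hi alpha beta : R) (F : probability R R) (B : set R) :
  density_between lo hi alpha beta F -> lo <= hi -> measurable B ->
  F ((fun x => Num.max lo (Num.min hi x)) @^-1` B) = F B.
Proof.
move=> [f [mf Ff f0 _]] lohi mB.
set c := fun x => _.
have mc : measurable_fun setT c.
  by apply: measurable_maxr => //; apply: measurable_minr.
have FI A : measurable A -> F A = F (A `&` `[lo, hi]).
  move=> mA; rewrite !Ff//; last exact: measurableI.
  rewrite [RHS]integral_mkcondr/=; apply: eq_integral => x xA.
  rewrite patchE; case: ifPn => //.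
  by rewrite notin_setE/= in_itv/= => /negP xab; rewrite f0.
have mcB : measurable (c @^-1` B) by rewrite -[X in measurable X]setTI; exact: mc.
rewrite FI// [RHS]FI//; congr (F _); apply/seteqP; split=> x [] /= Bx /[dup] xI;
  rewrite in_itv /= => /andP[lox xhi]; split=> //.
  by move: Bx; rewrite /c (min_idPr xhi) (max_idPr lox).
by rewrite /c (min_idPr xhi) (max_idPr lox).
Qed.

(** * Realizations driven by i.i.d. draws *)

Section IndependentFamily.
Context (R : realType) d (S : measurableType d) (T : nat).
Context d' (Om : measurableType d') (P : probability Om R).
Variables (mu : probability S R) (W : 'I_T -> Om -> S).
Hypothesis mW : forall t, measurable_fun setT (W t).
Hypothesis PW : forall B : 'I_T -> set S, (forall t, measurable (B t)) ->
  P [set w | forall t, B t (W t w)] = (\prod_(t < T) mu (B t))%E.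

Lemma iid_marginal t (B : set S) : measurable B -> P (W t @^-1` B) = mu B.
Proof.
move=> mB.
rewrite (_ : W t @^-1` B =
    [set w | forall s, (if s == t then B else setT) (W s w)]); last first.
  apply/seteqP; split=> w /= Bw; last by have := Bw t; rewrite eqxx.
  by move=> s; case: eqP => [->|].
rewrite (PW (B := fun s => if s == t then B else setT)) => [|s]; last by case: ifP.
rewrite (bigD1 t)//= eqxx big1 ?mule1// => s /negbTE ->.
exact: probability_setT.
Qed.

(** The types are deterministic: samples are constant and generate trivial sigma-algebras, while the
    query of period t is a function of [W t] alone. Mutual independence then reduces to that of the
    draws. *)
Lemma realization_of_iid (m n : nat) (I : problem R m n T)
    (ty : 'I_T -> 'I_n.+1) (g : 'I_n.+1 -> S -> R) :
  (forall t A, type_law I t A = \d_(ty t) A) ->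
  (forall j, measurable_fun setT (g j)) ->
  (forall j B, measurable B -> mu (g j @^-1` B) = reward_law I j B) ->
  exists X : realization I P,
    (forall t w, sample X t w = ty t) /\
    (forall t w, query X t w = (ty t, g (ty t) (W t w))).
Proof.
move=> type_lawE mg reward_lawE.
have mgB j B : measurable B -> measurable (g j @^-1` B).
  by move=> mB; rewrite -[X in measurable X]setTI; exact: mg.
have ms t : measurable_fun setT (cst (ty t) : Om -> 'I_n.+1) by [].
have mq t : measurable_fun setT (fun w => (ty t, g (ty t) (W t w))).
  apply: measurable_fun_pair => //.
  exact: measurableT_comp (mg _) (mW t).
pose s t : {mfun Om >-> 'I_n.+1} := mfun_Sub (mem_set (ms t)).
pose q t : {mfun Om >-> ('I_n.+1 * R)%type} := mfun_Sub (mem_set (mq t)).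
have s_law t (A : set 'I_n.+1) : P (s t @^-1` A) = type_law I t A.
  rewrite type_lawE diracE preimage_cst.
  by case: ifP => _; rewrite ?probability_setT ?measure0.
have q_law t j (B : set R) : measurable B ->
    P (q t @^-1` ([set j] `*` B)) = (type_law I t [set j] * reward_law I j B)%E.
  move=> mB; rewrite type_lawE diracE; have [tj|tj] := eqVneq (ty t) j.
    rewrite mem_set// mul1e -reward_lawE// -(iid_marginal t); last exact: mgB.
    by congr (P _); apply/seteqP; split=> w /=; rewrite tj => // -[].
  rewrite memNset; last exact/eqP.
  rewrite mul0e (_ : _ @^-1` _ = set0) ?measure0//.
  by apply/seteqP; split=> w //= -[/eqP]; rewrite (negbTE tj).
suff ind : mutually_independent P (fun u : ('I_T + 'I_T)%type =>
      match u with
      | inl t => g_sigma_algebra_preimage (s t)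
      | inr t => g_sigma_algebra_preimage (q t)
      end).
  by exists (Realization s_law q_law ind).
move=> J A AG.
pose idx (u : 'I_T + 'I_T) := match u with inl t => t | inr t => t end.
(* Each event is pulled back to a measurable set of draws of its period; indices outside [J] get the
   full set, so that all periods can be treated at once. *)
have /choice[C CP] u : exists C : set S, [/\ measurable C,
    u \in J -> A u = W (idx u) @^-1` C, u \notin J -> C = setT &
    if u is inl _ then C = setT \/ C = set0 else True].
  have [uJ|uJ] := boolP (u \in J); last by exists setT; split=> //; case: u uJ; auto.
  have := AG _ uJ; case: u {uJ} => t [B mB <-]; rewrite setTI.
    rewrite preimage_cst; case: ifP => _.
      by exists setT; split=> //; left.
    by exists set0; split=> //; right.
  exists (g (ty t) @^-1` [set x | B (ty t, x)]); split=> //.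
  apply: mgB; rewrite -[X in measurable X]setTI.
  have mpair : measurable_fun setT (pair (ty t) : R -> 'I_n.+1 * R).
    exact: measurable_fun_pair.
  exact: mpair.
have mC u : measurable (C u) by case: (CP u).
rewrite (_ : \bigcap_(u in [set` J]) A u =
    [set w | forall t, (C (inl t) `&` C (inr t)) (W t w)]); last first.
  apply/seteqP; split=> w /= Aw.
    suff CW u : C u (W (idx u) w).
      by move=> t; split; [exact: (CW (inl t))|exact: (CW (inr t))].
    have [_ AC CT _] := CP u; have [uJ|/CT -> //] := boolP (u \in J).
    by have := Aw _ uJ; rewrite AC.
  move=> u /= uJ; have [_ -> // _ _] := CP u.
  by case: u {uJ} => t; have [] := Aw t.
rewrite (PW (B := fun t => C (inl t) `&` C (inr t))) => [|t]; last exact: measurableI.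
(* The sample and the query of one period share a draw, yet the measure of the intersection factors
   because the sample's set is full or empty. *)
transitivity (\prod_u mu (C u))%E.
  rewrite big_sumType /= -big_split; apply: eq_bigr => t _ /=.
  by have [_ _ _ [] ->] := CP (inl t);
    rewrite ?setTI ?probability_setT ?mul1e// set0I measure0 mul0e.
rewrite [RHS]big_mkcond; apply: eq_bigr => u _.
have [_ AC CT _] := CP u; case: ifPn => [/AC ->|/CT ->].
  by rewrite iid_marginal.
exact: probability_setT.
Qed.

End IndependentFamily.

(** * Pathwise comparison of the two worlds *)

Lemma Voff_ge (R : realType) (m n T : nat) (C : 'I_m -> R)
    (a : 'I_n.+1 -> 'I_m -> R) (q : 'I_T -> 'I_n.+1 * R) (x : 'I_T -> bool) :
  feasible C a (fst \o q) x -> \sum_(t < T) (q t).2 * (x t)%:R <= Voff C a q.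
Proof.
move=> fx; pose x' := [ffun t => x t].
have x'E : x' =1 x by move=> t; rewrite ffunE.
under eq_bigr do rewrite -x'E.
apply: (le_bigmax_cond 0 (fun x : {ffun 'I_T -> bool} => \sum_(t < T) (q t).2 * (x t)%:R)).
by apply/forallP => i; under eq_bigr do rewrite x'E; exact: (forallP fx i).
Qed.

Lemma sum_prefix (R : realType) (T h : nat) :
  (h <= T)%N -> \sum_(t < T) (t < h)%:R = h%:R :> R.
Proof.
move=> hT; rewrite -[in RHS](card_ord h) -sumr_const (big_ord_widen T (fun=> 1))//.
by rewrite [RHS]big_mkcond; apply: eq_bigr => t _; case: (t < h)%N.
Qed.

(** Here u, x belong to the low world and v, y to the high one. The offline optimum is bounded below
    by serving periods [0, h) in the low world and [h, 2h) in the high one. Weak duality bounds what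
    x and y earn; per unit of h there remains 7/4 + 11/4 - 1 - 3 = 1/2. *)
Lemma two_world_gap (R : realType) (n T h : nat) (j : 'I_T -> 'I_n.+1)
    (u v : 'I_T -> R) (x y bad : 'I_T -> bool) :
  let C : 'I_1 -> R := fun=> h%:R in
  let a : 'I_n.+1 -> 'I_1 -> R := fun _ _ => 1 in
  (h.*2 <= T)%N ->
  (forall t : 'I_T, (t < h)%N -> [/\ u t = v t, x t = y t & 7 / 4 <= u t <= 2]) ->
  (forall t : 'I_T, (h <= t)%N ->
     [/\ u t <= 1 + 2 * (bad t)%:R, 0 <= v t <= 3 & 11 / 4 - 3 * (bad t)%:R <= v t]) ->
  feasible C a j x -> feasible C a j y ->
  h%:R / 2 - 5 * \sum_(t < T) (bad t)%:R <=
  (Voff C a (fun t => (j t, u t)) - \sum_(t < T) u t * (x t)%:R) +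
  (Voff C a (fun t => (j t, v t)) - \sum_(t < T) v t * (y t)%:R).
Proof.
move=> C a hT early late fx fy.
have hT1 : (h <= T)%N by apply: leq_trans hT; rewrite -addnn leq_addr.
have S1 := sum_prefix R hT1.
have S2 : \sum_(t < T) (t < h.*2)%:R = h%:R + h%:R :> R.
  by rewrite sum_prefix// -addnn natrD.
have total z : feasible C a j z = (\sum_(t < T) (z t)%:R <= h%:R :> R).
  apply/forallP/idP => [/(_ ord0)|zh i]; by under eq_bigr do rewrite mul1r.
have Vu : \sum_(t < T) u t * (t < h)%:R <= Voff C a (fun t => (j t, u t)).
  by apply: (@Voff_ge _ _ _ _ _ _ (fun t => (j t, u t))
    (fun t : 'I_T => (t < h)%N)); rewrite total S1.
have Vv : \sum_(t < T) v t * ((t < h.*2)%:R - (t < h)%:R) <=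
    Voff C a (fun t => (j t, v t)).
  have E (t : 'I_T) : (t < h.*2)%:R - (t < h)%:R = (h <= t < h.*2)%N%:R :> R.
    rewrite (leqNgt h); case: (ltnP t h) => th /=; last by rewrite subr0.
    by rewrite (leq_trans th) ?subrr// -addnn leq_addr.
  have -> : \sum_(t < T) v t * ((t < h.*2)%:R - (t < h)%:R) =
      \sum_(t < T) v t * (h <= t < h.*2)%N%:R.
    by apply: eq_bigr => t _; rewrite E.
  apply: (@Voff_ge _ _ _ _ _ _ (fun t => (j t, v t))
    (fun t : 'I_T => (h <= t < h.*2)%N)).
  rewrite total; under eq_bigr do rewrite -E.
  by rewrite sumrB S1 S2 addrK.
(* The first sum of [key] weakens the second termwise: x and y carry the
   Lagrange multipliers 1 and 3 of their capacity constraints. *)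
have key : \sum_(t < T) (7 / 4 * (t < h)%:R + 11 / 4 * ((t < h.*2)%:R - (t < h)%:R)
      - 5 * (bad t)%:R) <=
    \sum_(t < T) (u t * (t < h)%:R - u t * (x t)%:R
      + (v t * ((t < h.*2)%:R - (t < h)%:R) - v t * (y t)%:R)
      + (x t)%:R + 3 * (y t)%:R).
  apply: ler_sum => t _; case: (ltnP t h) => th.
    (* Early, the common decision earns 2u in total, at most the total price 1 + 3 since u is at
       most 2. Late, rewards exceed their prices by at most 2 in the low world, on bad draws only,
       and never in the high world; the shortfall of v below 11/4 adds at most 3, whence the 5. *)
    have [<- <- /andP[u1 u2]] := early t th.
    have -> : (t < h.*2)%N by rewrite (leq_trans th)// -addnn leq_addr.
    by case: (x t); case: (bad t); rewrite /=; nra.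
  have [u1 /andP[v0 v3] v1] := late t th; move: u1 v1.
  by case: (x t); case: (y t); case: (bad t); case: (t < h.*2)%N; rewrite /=; nra.
move: key; rewrite !(big_split, sumrN)/= -!mulr_sumr !sumrB S1 S2.
move: fx fy; rewrite !total.
set sx := \sum_(_ < _) (x _)%:R; set sy := \sum_(_ < _) (y _)%:R => fx fy.
lra.
Qed.

(** * Integrability of payoffs and passage to expectations *)

Section BoundedPayoffs.
Context (R : realType) d (Om : measurableType d) (P : probability Om R).

Lemma bounded_Lfun1 (X : Om -> R) (M : R) :
  measurable_fun setT X -> (forall w, 0 <= X w <= M) -> X \in Lfun P 1.
Proof.
move=> mX X0M; apply/Lfun1_integrable/measurable_bounded_integrable => //.
  by rewrite [X in (X < _)%E]probability_setT ltry.
exists M; split; first exact: num_real.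
move=> K MK w _ /=; have /andP[X0 XM] := X0M w.
by rewrite ger0_norm// (le_trans XM)// ltW.
Qed.

Lemma measurable_bigmax (I : Type) (s : seq I) (Q : pred I) (F : I -> Om -> R) :
  (forall i, measurable_fun setT (F i)) ->
  measurable_fun setT (fun w => \big[Num.max/0]_(i <- s | Q i) F i w).
Proof.
move=> mF; elim: s => [|i s IH].
  rewrite [X in measurable_fun _ X](_ : _ = cst 0)//.
  by apply/funext => w; rewrite big_nil.
pose g w := \big[Num.max/0]_(j <- s | Q j) F j w.
rewrite [X in measurable_fun _ X](_ : _ = if Q i then F i \max g else g).
  by case: ifP => // _; exact: measurable_maxr.
by apply/funext => w; rewrite big_cons; case: ifP.
Qed.

Context (m n T : nat) (C : 'I_m -> R) (a : 'I_n.+1 -> 'I_m -> R).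
Context (ty : 'I_T -> 'I_n.+1) (r : 'I_T -> Om -> R) (M : R).
Hypothesis mr : forall t, measurable_fun setT (r t).
Hypothesis r0M : forall t w, 0 <= r t w <= M.

Lemma payoff_bound w (x : 'I_T -> bool) :
  0 <= \sum_(t < T) r t w * (x t)%:R <= \sum_(t < T) M.
Proof.
apply/andP; split; [apply: sumr_ge0 | apply: ler_sum] => t _;
  by have /andP[r0 rM] := r0M t w; case: (x t) => /=; lra.
Qed.

(** As the types are fixed, feasibility does not depend on the outcome: the optimum is a maximum of
    measurable sums over a fixed finite set. *)
Lemma Voff_Lfun1 : (fun w => Voff C a (fun t => (ty t, r t w))) \in Lfun P 1.
Proof.
apply: (bounded_Lfun1 (M := \sum_(t < T) M)); last first.
  move=> w; apply/andP; split; first exact: bigmax_ge_id.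
  apply: bigmax_le => [|x _]; last by have /andP[] := payoff_bound w x.
  by have /andP[+ +] := payoff_bound w (fun=> true); exact: le_trans.
apply: (measurable_bigmax _ (fun x : {ffun 'I_T -> bool} => feasible C a ty x)
  (F := fun (x : {ffun 'I_T -> bool}) w => \sum_(t < T) r t w * (x t)%:R)) => x.
by apply: measurable_sum => t; exact: measurable_funM.
Qed.

Lemma policy_value_Lfun1 (pi : policy R m n T) (jhat : 'I_T -> 'I_n.+1) :
  (fun w => policy_value pi C a jhat (fun t => (ty t, r t w))) \in Lfun P 1.
Proof.
apply: (bounded_Lfun1 (M := \sum_(t < T) M)) => [|w]; last exact: payoff_bound.
apply: measurable_sum => t; apply: measurable_funM; first exact: mr.
have mh : measurable_fun setT (fun w => history (fun s => (ty s, r s w)) t).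
  apply/measurable_fun_tnthP => s.
  rewrite (_ : _ \o _ = fun w => let t' := widen_ord (ltn_ord t) s in (ty t', r t' w)).
    exact: measurable_fun_pair.
  by apply/funext => w /=; rewrite tnth_mktuple.
have mb : measurable_fun setT (fun b : bool => b%:R : R) by [].
exact: measurableT_comp mb (measurableT_comp (@decide_measurable _ _ _ _ pi C a jhat t) mh).
Qed.

(** Integrates a pathwise bound such as that of [two_world_gap]; by linearity the expected number of
    bad events is at most [#|I|] times eps. *)
Lemma expected_gap (I : finType) (V1 p1 V2 p2 : Om -> R) (Bad : I -> set Om)
    (A B eps : R) :
  V1 \in Lfun P 1 -> p1 \in Lfun P 1 -> V2 \in Lfun P 1 -> p2 \in Lfun P 1 ->
  (forall i, measurable (Bad i)) -> (forall i, (P (Bad i) <= eps%:E)%E) ->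
  0 <= A -> 0 <= B ->
  (forall w, A - B * \sum_i \1_(Bad i) w <= (V1 w - p1 w) + (V2 w - p2 w)) ->
  ((A - B * (#|I|%:R * eps))%:E <=
    ('E_P[V1] - 'E_P[p1]) + ('E_P[V2] - 'E_P[p2]))%E.
Proof.
move=> LV1 Lp1 LV2 Lp2 mBad PBad A0 B0 gap.
pose N w := \sum_i \1_(Bad i) w : R.
have mN : measurable_fun setT N by apply: measurable_sum => i; exact: measurable_indic.
have N0M w : 0 <= N w <= \sum_(i : I) 1.
  by apply/andP; split; [apply: sumr_ge0|apply: ler_sum] => i _;
    rewrite indicE; case: (_ \in _).
have LN : N \in Lfun P 1 by exact: bounded_Lfun1 mN N0M.
have mBN : measurable_fun setT (B \o* N) by exact: measurable_funM.
have LBN : B \o* N \in Lfun P 1.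
  apply: (bounded_Lfun1 mBN (M := \sum_(i : I) 1 * B)) => w /=.
  have /andP[N0 NM] := N0M w.
  by rewrite -mulr_suml mulr_ge0// ler_wpM2r.
have EN : ('E_P[N] <= (#|I|%:R * eps)%:E)%E.
  rewrite unlock; under eq_integral do rewrite -sumEFin.
  rewrite ge0_integral_sum//; last first.
    by move=> i; apply/measurable_EFinP; exact: measurable_indic.
  under eq_bigr do rewrite integral_indic// setIT.
  apply: (@le_trans _ _ (\sum_(i : I) eps%:E)%E).
    by apply: lee_sum => i _; exact: PBad.
  by rewrite sumEFin sumr_const mulr_natl.
pose G := (V1 \- p1) \+ (V2 \- p2).
have LG : G \in Lfun P 1 by rewrite rpredD// rpredB.
rewrite -!expectationB// -expectationD ?rpredB// -/G.
have mG : measurable_fun setT G.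
  by move/Lfun1_integrable/integrableP: LG => [/measurable_EFinP].
(* The bad count is moved to the right because monotonicity is applied to nonnegative functions, and
   the gap [G] alone may be negative. *)
have : ('E_P[cst A] <= 'E_P[G \+ B \o* N])%E.
  apply: expectation_le => //.
  - exact: measurable_funD.
  - move=> w; apply: (le_trans A0); rewrite /= -lerBlDr mulrC; exact: gap.
  - by apply: aeW => w; rewrite /= -lerBlDr mulrC; exact: gap.
rewrite expectation_cst expectationD// expectationZl//.
rewrite EFinB leeBlDr// => /le_trans; apply; rewrite leeD2l// EFinM.
by rewrite lee_wpmul2l ?lee_fin.
Qed.
End BoundedPayoffs.

(** * The two reward worlds and their coupling *)

Section TwoWorlds.
Context (R : realType) (F0 FL FH : probability R R).

(** The range of type 1 is the same in both worlds, since the bounds in [A1] are fixed before the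
    policy and hence before the world. *)
Definition reward_lo (j : 'I_2) : R := if j == ord0 then 7 / 4 else 1 / 2.
Definition reward_hi (j : 'I_2) : R := if j == ord0 then 2 else 3.

Definition world_law (high : bool) (j : 'I_2) : probability R R :=
  if j == ord0 then F0 else if high then FH else FL.

(* One draw serves both worlds, so that they agree pathwise on type 0. *)
Definition coupling : probability (R * (R * R))%type R := (F0 \x (FL \x FH))%E.

Definition world_coord (high : bool) (j : 'I_2) (s : R * (R * R)) : R :=
  if j == ord0 then s.1 else if high then s.2.2 else s.2.1.

(* Clamping does not change the laws, and makes the rewards bounded everywhere
   rather than almost surely. *)
Definition world_reward (high : bool) (j : 'I_2) (s : R * (R * R)) : R :=
  Num.max (reward_lo j) (Num.min (reward_hi j) (world_coord high j s)).

Lemma measurable_world_coord high j : measurable_fun setT (world_coord high j).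
Proof.
rewrite /world_coord; case: (j == ord0); first exact: measurable_fst.
by case: high; apply: measurableT_comp.
Qed.

Lemma measurable_world_reward high j : measurable_fun setT (world_reward high j).
Proof.
apply: measurable_maxr => //; apply: measurable_minr => //.
exact: measurable_world_coord.
Qed.

Lemma couplingX (A B C : set R) : measurable A -> measurable B -> measurable C ->
  coupling (A `*` (B `*` C)) = (F0 A * (FL B * FH C))%E.
Proof.
move=> mA mB mC; rewrite [LHS]product_measure1E//; last exact: measurableX.
by congr (_ * _)%E; exact: product_measure1E.
Qed.

Lemma coupling_coord high j (B : set R) : measurable B ->
  coupling (world_coord high j @^-1` B) = world_law high j B.
Proof.
move=> mB; rewrite /world_coord /world_law; case: (j == ord0).
  rewrite (_ : _ @^-1` B = B `*` ([set: R] `*` [set: R])).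
    by rewrite couplingX// !probability_setT !mule1.
  by apply/seteqP; split=> -[x [y z]] //= [].
case: high.
  rewrite (_ : _ @^-1` B = [set: R] `*` ([set: R] `*` B)).
    by rewrite couplingX// !probability_setT !mul1e.
  by apply/seteqP; split=> -[x [y z]] //= [_ []].
rewrite (_ : _ @^-1` B = [set: R] `*` (B `*` [set: R])).
  by rewrite couplingX// !probability_setT mul1e mule1.
by apply/seteqP; split=> -[x [y z]] //= [_ []].
Qed.

Lemma reward_lo_hi j : 0 < reward_lo j < reward_hi j.
Proof. by rewrite /reward_lo /reward_hi; case: ifP => _; apply/andP; split; lra. Qed.

Lemma world_reward_bounds high j s :
  reward_lo j <= world_reward high j s <= reward_hi j.
Proof.
have /andP[_ /ltW lohi] := reward_lo_hi j.
by rewrite /world_reward le_max lexx ge_max lohi ge_min lexx.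
Qed.

Variables (alpha beta : R).
Hypothesis alpha_beta : 0 < alpha < beta.
Hypothesis density : forall high j,
  density_between (reward_lo j) (reward_hi j) alpha beta (world_law high j).

Lemma coupling_reward high j (B : set R) : measurable B ->
  coupling (world_reward high j @^-1` B) = world_law high j B.
Proof.
move=> mB; have /andP[_ /ltW lohi] := reward_lo_hi j.
rewrite -(law_clamp (density high j) lohi mB) -coupling_coord//.
rewrite -[X in measurable X]setTI.
by apply: measurable_maxr => //; apply: measurable_minr.
Qed.

Definition low_rewards : set R := `[1 / 2, 1]%classic.
Definition high_rewards : set R := `[11 / 4, 3]%classic.

Definition good : set (R * (R * R)) :=
  [set: R] `*` (low_rewards `*` high_rewards).

Lemma measurable_low : measurable low_rewards.
Proof. exact: measurable_itv. Qed.

Lemma measurable_high : measurable high_rewards.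
Proof. exact: measurable_itv. Qed.

Lemma measurable_good : measurable good.
Proof.
apply: measurableX => //; apply: measurableX.
  exact: measurable_low.
exact: measurable_high.
Qed.

Hypothesis FL_low : ((1 - 120^-1)%:E <= FL low_rewards)%E.
Hypothesis FH_high : ((1 - 120^-1)%:E <= FH high_rewards)%E.

(** The two type-1 coordinates are independent, and (1 - 1/120)^2 is at least 1 - 1/60. *)
Lemma coupling_bad : (coupling (~` good) <= (60^-1)%:E)%E.
Proof.
rewrite probability_setC; last exact: measurable_good.
rewrite couplingX ?probability_setT ?mul1e//;
  [|exact: measurable_low|exact: measurable_high].
rewrite leeBlDr; last by rewrite fin_numM//; apply: fin_num_measure;
  [exact: measurable_low|exact: measurable_high].
have : ((1 - 120^-1)%:E * (1 - 120^-1)%:E <= FL low_rewards * FH high_rewards)%E.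
  by apply: lee_pmul => //; rewrite lee_fin; lra.
move=> /(leeD2l (60^-1)%:E); apply: le_trans.
rewrite -EFinM -EFinD lee_fin; lra.
Qed.

(** * The two instances and the sum of their regrets *)

Context (T : nat).
Hypothesis T2 : (2 <= T)%N.
Let h := T./2.
Let h0 : (0 < h)%N. Proof. by rewrite half_gt0. Qed.
Let hT : (h.*2 <= T)%N. Proof. by rewrite -[leqRHS]odd_double_half leq_addl. Qed.
Let hT1 : (h < T)%N. Proof. by apply: leq_trans hT; rewrite -addnn -addn1 leq_add2l. Qed.

Definition arrival (t : 'I_T) : 'I_2 := if (t < T./2)%N then ord0 else ord_max.

Let capacity_nonneg (i : 'I_1) : 0 <= h%:R :> R. Proof. by []. Qed.
Let consumption_nonneg (j : 'I_2) (i : 'I_1) : 0 <= 1 :> R. Proof. by []. Qed.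

Definition world (high : bool) : problem R 1 1 T :=
  @Problem R 1 1 T (fun=> h%:R) (fun _ _ => 1) (fun t => \d_(arrival t))
    (world_law high) capacity_nonneg consumption_nonneg.

Lemma world_A1 high : A1 reward_lo reward_hi alpha beta (world high).
Proof. by split=> // j; [exact: reward_lo_hi | exact: density]. Qed.

Context d (Om : measurableType d) (P : probability Om R).
Variable W : 'I_T -> Om -> R * (R * R).
Hypothesis mW : forall t, measurable_fun setT (W t).
Hypothesis PW : forall B : 'I_T -> set (R * (R * R)),
  (forall t, measurable (B t)) ->
  P [set w | forall t, B t (W t w)] = (\prod_(t < T) coupling (B t))%E.

(** A realization prescribes only laws. This ties those of both worlds to the same draws [W], so
    that their regrets can be compared pathwise. *)
Definition realizes high (X : realization (world high) P) :=
  (forall t w, sample X t w = arrival t) /\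
  (forall t w, query X t w = (arrival t, world_reward high (arrival t) (W t w))).

Lemma realizes_exists high : exists X : realization (world high) P, realizes X.
Proof.
apply: (realization_of_iid mW PW (g := world_reward high)) => //.
  exact: measurable_world_reward.
by move=> j B mB; exact: coupling_reward.
Qed.

Lemma realizes_A2 high (X : realization (world high) P) : realizes X -> A2 X.
Proof.
move=> [sX _] j.
rewrite (_ : [set _ | _] = setT) ?probability_setT//.
apply/seteqP; split=> w //= _.
(* Period 0 has type 0 and period h has type 1; both exist as 0 < h < T. *)
have [t tj] : exists t, arrival t = j.
  have [->|j0] := eqVneq j ord0.
    by exists (Ordinal (ltn_trans h0 hT1)); rewrite /arrival /= -/h h0.
  exists (Ordinal hT1); rewrite /arrival /= ltnn.
  by apply/val_inj; case: j j0 => -[|[|]].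
by rewrite (bigD1 t)//= sX tj eqxx.
Qed.

Lemma regret_sum (pi : policy R 1 1 T)
    (XL : realization (world false) P) (XH : realization (world true) P) :
  realizes XL -> realizes XH ->
  ((T%:R / 12)%:E <= regret pi XL + regret pi XH)%E.
Proof.
move=> [sL qL] [sH qH].
pose r high (t : 'I_T) w := world_reward high (arrival t) (W t w).
have mr high t : measurable_fun setT (r high t).
  exact: measurableT_comp (measurable_world_reward high _) (mW t).
have r0M high t w : 0 <= r high t w <= 3.
  have /andP[lo hi] := world_reward_bounds high (arrival t) (W t w).
  apply/andP; split; [apply: le_trans lo | apply: (le_trans hi)];
    by rewrite /reward_lo /reward_hi; case: ifP => _; lra.
pose C : 'I_1 -> R := fun=> h%:R.
pose a : 'I_2 -> 'I_1 -> R := fun _ _ => 1.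
pose V high w := Voff C a (fun t => (arrival t, r high t w)).
pose p high w := policy_value pi C a arrival (fun t => (arrival t, r high t w)).
have regretE high (X : realization (world high) P) : realizes X ->
    regret pi X = ('E_P[V high] - 'E_P[p high])%E.
  move=> [sX qX]; rewrite /regret; congr ('E_P[_] - 'E_P[_])%E; apply/funext => w.
    by congr Voff; apply/funext => t; exact: qX.
  by congr policy_value; apply/funext => t; [exact: sX | exact: qX].
rewrite !regretE//.
pose Bad t := W t @^-1` (~` good).
have mgoodC : measurable (~` good) by apply: measurableC; exact: measurable_good.
(* Since T is at most 3h, h/2 is at least T/6, while the bad draws cost at most 5T/60 = T/12. *)
apply: (@le_trans _ _ (h%:R / 2 - 5 * (#|'I_T|%:R * 60^-1))%:E).
  rewrite card_ord lee_fin.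
  have : T%:R <= 3 * h%:R :> R.
    rewrite -natrM ler_nat -[leqLHS]odd_double_half -/h -mul2n mulSn.
    by rewrite leq_add2r (leq_trans (leq_b1 _)).
  lra.
apply: (expected_gap (Bad := Bad)); rewrite ?divr_ge0//.
- exact: Voff_Lfun1.
- exact: policy_value_Lfun1.
- exact: Voff_Lfun1.
- exact: policy_value_Lfun1.
- by move=> t; rewrite -[X in measurable X]setTI; exact: mW.
- by move=> t; rewrite (iid_marginal PW)//; exact: coupling_bad.
move=> w.
pose x high (t : 'I_T) := decide pi C a arrival
  (history (fun t => (arrival t, r high t w)) t).
under eq_bigr do rewrite indicE.
apply: (@two_world_gap R 1 T h arrival (r false ^~ w) (r true ^~ w)
  (x false) (x true) (fun t => w \in Bad t)) => //.
- move=> t th.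
  have rE (s : 'I_T) : (s < h)%N -> r false s w = r true s w.
    by move=> sh; rewrite /r /world_reward /world_coord /arrival -/h sh.
  split; first exact: rE.
    (* Before period h the history holds only type-0 rewards, which agree in the two worlds, and the
       samples agree as well: the policy sees the same data. *)
    rewrite /x; congr decide; apply: eq_mktuple => s /=.
    by rewrite rE//; apply: leq_ltn_trans th; rewrite /= -ltnS.
  have := world_reward_bounds false (arrival t) (W t w).
  by rewrite /r /arrival -/h th.
- move=> t th.
  have atE : arrival t = ord_max by rewrite /arrival -/h ltnNge th.
  have := world_reward_bounds false (arrival t) (W t w).
  have := world_reward_bounds true (arrival t) (W t w).
  rewrite -/(r _ t w) -/(r _ t w) atE /reward_lo /reward_hi /=.
  move=> /andP[H1 H2] /andP[L1 L2].
  (* On a bad draw the clamped range [1/2, 3] alone suffices, as 3 = 1 + 2 and 11/4 - 3 < 1/2. *)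
  have [bad|/negP ngood] := boolP (w \in Bad t).
    by rewrite /=; split; [|apply/andP; split|]; lra.
  have : good (W t w) by apply: contrapT => g; apply: ngood; rewrite inE.
  move=> [_ []]; rewrite /low_rewards /high_rewards /= !in_itv /=.
  move=> /andP[l1 l2] /andP[g1 g2].
  split; rewrite /=.
  + rewrite /r /world_reward atE /world_coord /reward_lo /reward_hi /=.
    by rewrite mulr0 addr0 ge_max ge_min l2 orbT andbT; lra.
  + by apply/andP; split; lra.
  + rewrite /r /world_reward atE /world_coord /reward_lo /reward_hi /=.
    by rewrite mulr0 subr0 le_max le_min g1 andbT; apply/orP; right; lra.
- by apply: (decide_feasible pi).
- by apply: (decide_feasible pi).
Qed.

End TwoWorlds.

(** * Choice of the laws, the constants and the worse world *)

Theorem theorem2 (R : realType) :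
  exists (c : R) (m n : nat) (rlo rhi : 'I_n.+1 -> R) (alpha beta : R)
         (T0 : nat),
    0 < c /\
    forall T : nat, (T0 <= T)%N ->
    forall pi : policy R m n T,
    exists I : problem R m n T,
      A1 rlo rhi alpha beta I /\
      exists (d : measure_display) (Omega : measurableType d)
             (Pr : probability Omega R) (X : realization I Pr),
        A2 X /\ ((c * T%:R)%:E <= regret pi X)%E.
Proof.
have p01 : 0 <= (120^-1 : R) <= 1 by lra.
(* With [a, b] = [lo, hi] the mixture is the uniform law itself. *)
have [F0 [D0 _]] := @concentrated_law R 120^-1 (7 / 4) 2 (7 / 4) 2 p01
  ltac:(lra) ltac:(lra) ltac:(lra).
have [FL [DL FL_low]] := @concentrated_law R 120^-1 (1 / 2) 3 (1 / 2) 1 p01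
  ltac:(lra) ltac:(lra) ltac:(lra).
have [FH [DH FH_high]] := @concentrated_law R 120^-1 (1 / 2) 3 (11 / 4) 3 p01
  ltac:(lra) ltac:(lra) ltac:(lra).
(* The smallest lower bound is that of type 1, (1/120)(2/5) = 1/300; the largest upper bound is that
   of type 0, 4 + 4 = 8. *)
have density high j : density_between (reward_lo R j) (reward_hi R j) 300^-1 8
    (world_law F0 FL FH high j).
  rewrite /reward_lo /reward_hi /world_law.
  have weaken lo hi al be F : 300^-1 <= al -> be <= 8 ->
      density_between lo hi al be F -> density_between lo hi (300^-1 : R) 8 F.
    move=> al1 be8 [f [mf Ff f0 fb]]; exists f; split=> // x /fb /andP[f1 f2].
    by rewrite (le_trans al1)// (le_trans f2).
  have E0 : (2 - 7 / 4)^-1 = 4 :> R by field.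
  have EL : (3 - 1 / 2)^-1 = 2 / 5 :> R by field.
  have EL' : (1 - 1 / 2)^-1 = 2 :> R by field.
  have EH : (3 - 11 / 4)^-1 = 4 :> R by field.
  case: (j == ord0); first by apply: weaken D0; rewrite E0; lra.
  case: high; [apply: weaken DH | apply: weaken DL];
    by rewrite EL ?EL' ?EH; lra.
exists 24^-1, 1%N, 1%N, (@reward_lo R), (@reward_hi R), 300^-1, 8, 2%N.
split=> // T T2 pi.
have [d [Om [P [W [mW PW]]]]] :=
  @independent_family R _ _ T (fun=> coupling F0 FL FH).
have [XL rXL] := @realizes_exists R F0 FL FH _ _ density T _ _ _ W mW PW false.
have [XH rXH] := @realizes_exists R F0 FL FH _ _ density T _ _ _ W mW PW true.
have := regret_sum FL_low FH_high T2 mW PW pi rXL rXH.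
have [LT|LT] := leP (24^-1 * T%:R)%:E (regret pi XL).
  move=> _; exists (world F0 FL FH T false); split;
    first by apply: world_A1 => //; lra.
  by exists d, Om, P, XL; split=> //; exact: realizes_A2 rXL.
move=> sum_ge; exists (world F0 FL FH T true); split;
  first by apply: world_A1 => //; lra.
exists d, Om, P, XH; split; first exact: realizes_A2 rXH.
rewrite leNgt; apply/negP => HT; move: sum_ge; apply/negP; rewrite -ltNge.
apply: (lt_le_trans (lteD LT HT)).
by rewrite -EFinD lee_fin; lra.
Qed.
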